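(* Let $A$ be an integral domain and $E$ a finitely generated comultiplication $A$-module. The following are equivalent: (i) $E$ is a quasi second $A$-module; (ii) $aE$ is a second submodule of $E$ for every $a\in W(E)^{\#}$; (iii) $\operatorname{ann}(aE)$ is a maximal ideal of $A$ for every $a\in W(E)^{\#}$.
   Context: For an $A$-module $M$: $\operatorname{ann}(M)=\{a\in A: aM=0\}$, $W(M)=\{a\in A: aM\neq M\}$, $W(M)^{\#}=W(M)\setminus\operatorname{ann}(M)$. $E$ is a quasi second module if for all $a,b\in A$, $0\neq bE\subseteq aE\neq E$ implies $bE=aE$. A nonzero submodule $L$ of $E$ is second if for every $x\in A$ either $xL=L$ or $xL=0$. $E$ is a comultiplication module if for every submodule $N$ of $E$ there is an ideal $I$ of $A$ with $N=\operatorname{ann}_E(I)=\{m\in E: Im=0\}$. *)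

(* Defs.v *)
From mathcomp Require Import all_boot all_algebra.
From mathcomp Require Import boolp classical_sets.

Set Implicit Arguments.
Unset Strict Implicit.
Unset Printing Implicit Defensive.

Import GRing.Theory.
Local Open Scope ring_scope.
Local Open Scope classical_set_scope.

Definition submodule (A : comNzRingType) (E : lmodType A) (N : set E) : Prop :=
  submod_closed (mem N).

(** Ideals of [A] are the submodules of the regular module [A^o]; the unit
    ideal is allowed. *)
Definition ideal (A : comNzRingType) (I : set A) : Prop :=
  @submodule A A^o I.

(** [idealr_closed] is closure as a left ideal, together with [1 \notin I];
    it describes the proper ideals. *)
Definition maximal_ideal (A : comNzRingType) (m : set A) : Prop :=
  idealr_closed (mem m) /\
  (forall J : set A, idealr_closed (mem J) -> m `<=` J -> J = m).

Definition scale_set (A : comNzRingType) (E : lmodType A) (a : A) (N : set E) :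
  set E := [set a *: x | x in N].

Definition ann (A : comNzRingType) (E : lmodType A) (N : set E) : set A :=
  [set a | scale_set a N = [set 0]].

Definition ann_in (A : comNzRingType) (E : lmodType A) (I : set A) : set E :=
  [set x | forall a, I a -> a *: x = 0].

Definition W (A : comNzRingType) (E : lmodType A) : set A :=
  [set a | scale_set a [set: E] <> [set: E]].

Definition Wsharp (A : comNzRingType) (E : lmodType A) : set A :=
  W E `\` ann [set: E].

Definition quasi_second (A : comNzRingType) (E : lmodType A) : Prop :=
  forall a b : A,
    scale_set b [set: E] <> [set 0] ->
    scale_set b [set: E] `<=` scale_set a [set: E] ->
    scale_set a [set: E] <> [set: E] ->
    scale_set b [set: E] = scale_set a [set: E].

Definition second_submodule (A : comNzRingType) (E : lmodType A) (L : set E) :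
  Prop :=
  [/\ submodule L, L <> [set 0] &
      forall x : A, scale_set x L = L \/ scale_set x L = [set 0]].

Definition comultiplication (A : comNzRingType) (E : lmodType A) : Prop :=
  forall N : set E, submodule N ->
    exists2 I : set A, ideal I & N = ann_in I.

Definition finitely_generated (A : comNzRingType) (E : lmodType A) : Prop :=
  exists (n : nat) (e : 'I_n -> E),
    forall x : E, exists c : 'I_n -> A, x = \sum_i c i *: e i.

(* Main.v *)
Require Import Defs.
From mathcomp Require Import all_boot all_algebra.
From mathcomp Require Import boolp classical_sets.

(** Each submodule [a E] with [0 <> a E <> E] is governed by how scalars act on
    it, and the three conditions are three descriptions of that action.

    If [E] is quasi second, then [x (a E)] is again of the form [b E] and lies
    inside [a E], so it is [0] or [a E]: this is secondness of [a E].

    If [a E] is second, its annihilator is maximal because [a E] is finitely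
    generated: a scalar [x] outside the annihilator satisfies
    [x (a E) = a E], so by Nakayama's lemma ([nakayama_scale]) some
    [1 - x y] kills [a E]; hence an ideal containing both [x] and the
    annihilator contains [1].

    Finally, an inclusion [b E `<=` a E] between nonzero proper submodules
    gives an inclusion [ann (a E) `<=` ann (b E)] of maximal ideals, hence an
    equality; in a comultiplication module a submodule is determined by its
    annihilator ([comultiplication_ann_sub]), so [b E = a E]. *)

Set Implicit Arguments.
Unset Strict Implicit.
Unset Printing Implicit Defensive.

Import GRing.Theory.
Local Open Scope ring_scope.
Local Open Scope classical_set_scope.

(** The adjugate multiplies [M] to [\det M], so Cramer's rule applies to
    vectors with entries in any module. *)
Lemma det_scale_eq0 (A : comNzRingType) (E : lmodType A) (n : nat)
    (M : 'M[A]_n) (v : 'I_n -> E) :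
  (forall i, \sum_j M i j *: v j = 0) -> forall k, \det M *: v k = 0.
Proof.
move=> Mv0 k.
have -> : \det M *: v k = \sum_j (\adj M *m M) k j *: v j.
  rewrite mul_adj_mx (bigD1 k) //= big1 ?addr0; first by rewrite mxE eqxx.
  by move=> j jk; rewrite mxE eq_sym (negPf jk) scale0r.
under eq_bigr => j _ do rewrite mxE scaler_suml.
rewrite exchange_big big1 //= => i _.
under eq_bigr => j _ do rewrite -scalerA.
by rewrite -scaler_sumr Mv0 scaler0.
Qed.

(** The determinant of [1 - X C] is a polynomial in [X] with constant term
    [1]. *)
Lemma det_1_sub_scale (A : comNzRingType) (n : nat) (C : 'M[A]_n) (x : A) :
  exists y, \det (1%:M - x *: C) = 1 - x * y.
Proof.
pose p := \det (1%:M - 'X *: map_mx polyC C).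
have pE t : p.[t] = \det (1%:M - t *: C).
  rewrite -[p.[t]]/(horner_eval t p) -det_map_mx; congr (\det _).
  apply/matrixP => i j.
  by rewrite !mxE rmorphB rmorph_nat rmorphM /= /horner_eval hornerX hornerC.
have /factor_theorem[q pq] : root (p - 1) 0.
  by rewrite rootE !hornerE pE scale0r subr0 det1 subrr.
exists (- q.[x]); rewrite -pE -[p](subrK 1) pq !hornerE.
by rewrite subr0 mulrN opprK addrC mulrC.
Qed.

(** The determinant trick: [1 - x C] kills the vector of generators, hence so
    does its determinant, which is congruent to [1] modulo [x]. Spelling out
    the coefficients spares the quotient by the ideal [x A]. *)
Lemma nakayama_scale (A : comNzRingType) (E : lmodType A) (n : nat)
    (v : 'I_n -> E) (x : A) (C : 'M[A]_n) :
  (forall i, v i = x *: \sum_j C i j *: v j) ->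
  exists y, forall i, (1 - x * y) *: v i = 0.
Proof.
move=> vE; have [y dE] := det_1_sub_scale C x; exists y => i.
rewrite -dE; apply: det_scale_eq0 => k.
under eq_bigr => j _ do rewrite !mxE scalerBl -scalerA.
rewrite sumrB -scaler_sumr -vE (bigD1 k) //= big1 ?addr0.
  by rewrite eqxx scale1r subrr.
by move=> j jk; rewrite eq_sym (negPf jk) scale0r.
Qed.

Lemma scale_setP (A : comNzRingType) (E : lmodType A) (a : A) (z : E) :
  scale_set a [set: E] (a *: z).
Proof. by exists z. Qed.

Lemma scale_set_comp (A : comNzRingType) (E : lmodType A) (a b : A) (N : set E) :
  scale_set a (scale_set b N) = scale_set (a * b) N.
Proof.
rewrite /scale_set image_comp; congr (_ @` _).
by apply/funext => z /=; rewrite scalerA.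
Qed.

Lemma scale_set_submodule (A : comNzRingType) (E : lmodType A) (a : A) :
  submodule (scale_set a [set: E]).
Proof.
split; first by rewrite in_setE; exists 0; rewrite ?scaler0.
move=> c u w; rewrite !in_setE => -[u' _ <-] [w' _ <-].
by exists (c *: u' + w') => //; rewrite scalerDr !scalerA mulrC.
Qed.

Lemma annP (A : comNzRingType) (E : lmodType A) (N : set E) (c : A) :
  N !=set0 -> ann N c <-> forall z, N z -> c *: z = 0.
Proof.
move=> [z0 Nz0]; split => [cN z Nz|c0].
  by have : scale_set c N (c *: z) by [exists z]; rewrite cN.
apply/seteqP; split => [_ [z Nz <-]|_ ->] /=; first exact: c0.
by exists z0 => //; exact: c0.
Qed.

Lemma ann_scale_setP (A : comNzRingType) (E : lmodType A) (a c : A) :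
  ann (scale_set a [set: E]) c <-> forall z : E, c *: (a *: z) = 0.
Proof.
rewrite annP; last by exists (a *: 0); exact: scale_setP.
by split=> [h z|h _ [z _ <-]]; [apply: h; exact: scale_setP|].
Qed.

Lemma ann_scale_set_idealr_closed (A : comNzRingType) (E : lmodType A) (a : A) :
  scale_set a [set: E] <> [set 0] ->
  idealr_closed (mem (ann (scale_set a [set: E]))).
Proof.
move=> aE0; split.
- by rewrite in_setE; apply/ann_scale_setP => z; rewrite scale0r.
- apply/negP; rewrite in_setE => /ann_scale_setP a1; apply: aE0.
  apply/seteqP; split => [_ [z _ <-]|_ ->] /=; first by rewrite -[LHS]scale1r.
  by exists 0; rewrite ?scaler0.
- move=> c u w; rewrite !in_setE => /ann_scale_setP u0 /ann_scale_setP w0.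
  by apply/ann_scale_setP => z; rewrite scalerDl -scalerA u0 w0 scaler0 addr0.
Qed.

(** A scalar [x] outside the annihilator acts surjectively on [a E]; finite
    generation turns this into invertibility of [x] modulo the annihilator. *)
Lemma second_ann_maximal (A : comNzRingType) (E : lmodType A) (a : A) :
  finitely_generated E -> second_submodule (scale_set a [set: E]) ->
  maximal_ideal (ann (scale_set a [set: E])).
Proof.
move=> [n [e eE]] [_ aE0 aE2].
split; first exact: ann_scale_set_idealr_closed.
move=> J [_ J1 JD] annJ; apply/seteqP; split=> // x Jx.
have [xaE|//] := aE2 x.
(* In this case [x] is invertible modulo the annihilator, so [1 \in J],
   against [J1]. *)
have /choice[c cE] (i : 'I_n) : exists c : 'I_n -> A,
    a *: e i = x *: \sum_j c j *: (a *: e j).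
  have := scale_setP a (e i); rewrite -{1}xaE => -[_ [z _ <-] <-].
  have [c ->] := eE z; exists c; congr (_ *: _); rewrite scaler_sumr.
  by apply: eq_bigr => j _; rewrite !scalerA mulrC.
have [|y y0] := @nakayama_scale A E n (fun i => a *: e i) x (\matrix_(i, j) c i j).
  by move=> i; rewrite {1}cE; under [in RHS]eq_bigr => j _ do rewrite mxE.
have Jy : J (1 - x * y).
  apply/annJ/ann_scale_setP => z; have [d ->] := eE z.
  rewrite !scaler_sumr big1 // => j _.
  rewrite (scalerA a) (mulrC a) -scalerA scalerA (mulrC (1 - _)) -scalerA.
  by rewrite y0 scaler0.
case/negP: J1; rewrite -[1](subrK (x * y)) addrC [x in x + _]mulrC.
by apply: JD; rewrite in_setE.
Qed.

(** In [N = ann_in I] the ideal [I] lies in the annihilator of [N], so whatever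
    the annihilator of [N] kills is already in [N]. *)
Lemma comultiplication_ann_sub (A : comNzRingType) (E : lmodType A)
    (N L : set E) :
  comultiplication E -> submodule N -> L !=set0 -> ann N `<=` ann L -> L `<=` N.
Proof.
move=> hE sN L0 NL z Lz; have [I _ NI] := hE N sN.
have N0 : N !=set0 by exists 0; case: sN; rewrite in_setE.
rewrite NI => c Ic; apply: ((annP _ L0).1 _ z Lz).
by apply/NL/annP => // w; rewrite NI; exact.
Qed.

Theorem corollary7 (A : idomainType) (E : lmodType A)
    (hfg : finitely_generated E) (hcomult : comultiplication E) :
  [<-> quasi_second E;
       forall a : A, Wsharp E a -> second_submodule (scale_set a [set: E]%classic);
       forall a : A, Wsharp E a -> maximal_ideal (ann (scale_set a [set: E]%classic))].
Proof.
tfae.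
- move=> qs a [aE aE0]; split => //; first exact: scale_set_submodule.
  move=> x; rewrite scale_set_comp.
  have [->|xaE0] := pselect (scale_set (x * a) [set: E] = [set 0]); first by right.
  left; apply: qs => // _ [z _ <-].
  by exists (x *: z) => //; rewrite scalerA mulrC.
- by move=> h a /h; exact: second_ann_maximal.
- move=> h a b bE0 ba aE; apply/seteqP; split=> //.
  have aE0 : scale_set a [set: E] <> [set 0].
    move=> aE0; apply: bE0; apply/seteqP; split; first by rewrite -aE0.
    by move=> _ -> /=; exists 0; rewrite ?scaler0.
  have bE : scale_set b [set: E] <> [set: E].
    by move=> bE; apply: aE; apply/seteqP; split=> // z Ez; apply: ba; rewrite bE.
  have [_ amax] : maximal_ideal (ann (scale_set a [set: E])) by exact: h.
  have [bid _] : maximal_ideal (ann (scale_set b [set: E])) by exact: h.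
  apply: comultiplication_ann_sub => //; first exact: scale_set_submodule.
    by exists (a *: 0); exact: scale_setP.
  rewrite (amax _ bid) // => c /ann_scale_setP c0.
  by apply/ann_scale_setP => z; have [w _ <-] := ba _ (scale_setP b z).
Qed.
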